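(* Let $G=(V,E)$ be a finite graph. Let $\Gamma$ be a group that acts on $G$ by automorphisms (orientation of edges is allowed to be reversed by an automorphism). Let $\mathcal{S}=\{S_i\subset V: i\in V\}$ be a family of subsets of $V$ that is invariant under the action of $\Gamma$, i.e. $\gamma(S_i)=S_{\gamma(i)}$ for each $\gamma\in\Gamma$ and $i\in V$. 1. If $\Gamma$ acts transitively on the vertices of $G$, then there exists an optimal solution of the weighted isoperimetric inequalities problem (W) at scale $\mathcal{S}$ such that $\eta_i=\eta_j$ for each $i,j\in V$. 2. If $\Gamma$ acts transitively on the edges of $G$, then there exists an optimal solution of (W) at scale $\mathcal{S}$ such that $\kappa_{ij}=\frac{1}{|E|}$ for each $ij\in E$. 3. If $\Gamma$ acts transitively on both the edges and the vertices of $G$, then there exists an optimal solution of (W) at scale $\mathcal{S}$ such that $\eta_i=\eta_j$ for each $i,j\in V$ and $\kappa_{ij}=\frac{1}{|E|}$ for each $ij\in E$.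
   Context: A graph $G=(V,E)$ is oriented, with $E\subset V\times V$ and no self-loops; $ij\in E$ denotes an edge with initial vertex $i$ and terminal vertex $j$. Automorphisms are not required to preserve the orientation of edges; accordingly, when $ij\in E$, one defines $\kappa_{ji}$ to be equal to $\kappa_{ij}$. For $T\subset V$ the edge boundary is $\partial T=\big((T\times(V\setminus T))\cup((V\setminus T)\times T)\big)\cap E$. The weighted isoperimetric inequalities problem (W) at scale $\mathcal{S}$ is the linear problem: maximize $\sum_{i\in V}\eta_i$ subject to - $\sum_{ij\in E}\kappa_{ij}\le 1$; - $\sum_{i\in T}\eta_i\le\sum_{ij\in\partial T}\kappa_{ij}$ for each $T\subset V$ contained in some $S\in\mathcal{S}$; - $\kappa_{ij}\ge 0$ for $ij\in E$, and $\eta_i\in\mathbb{R}$ for $i\in V$.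
   Formalization: The formal theorem additionally assumes that every vertex lies in some S_j; otherwise some η_i is unconstrained, (W) is unbounded and has no optimal solution (e.g. all S_i empty), so the claim would be false. *)

(* Defs.v *)
From HB Require Import structures.
From mathcomp Require Import all_boot all_order all_algebra all_fingroup.
From mathcomp Require Import reals.

Set Implicit Arguments.
Unset Strict Implicit.
Unset Printing Implicit Defensive.

Import Order.TTheory GRing.Theory Num.Theory.

Local Open Scope ring_scope.

(* At most one of ij, ji is an edge: this is what makes the convention
   kappa_ji := kappa_ij (for ij an edge) meaningful. *)
Definition oriented_graph (V : finType) (E : {set V * V}) : Prop :=
  (forall i, (i, i) \notin E) /\
  (forall i j, (i, j) \in E -> (j, i) \notin E).

Definition adjacent (V : finType) (E : {set V * V}) (i j : V) : bool :=
  ((i, j) \in E) || ((j, i) \in E).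

(* Automorphisms may reverse the orientation of edges. *)
Definition graph_automorphism (V : finType) (E : {set V * V}) (f : V -> V)
    : Prop :=
  bijective f /\ forall i j, adjacent E (f i) (f j) = adjacent E i j.

Definition group_action (Gamma : groupType) (V : Type)
    (act : Gamma -> V -> V) : Prop :=
  (forall i, act 1%g i = i) /\
  (forall g h i, act (g * h)%g i = act g (act h i)).

Definition acts_by_automorphisms (V : finType) (E : {set V * V})
    (Gamma : groupType) (act : Gamma -> V -> V) : Prop :=
  group_action act /\ forall g, graph_automorphism E (act g).

Definition vertex_transitive (V : finType) (Gamma : groupType)
    (act : Gamma -> V -> V) : Prop :=
  forall i j, exists g, act g i = j.

Definition edge_transitive (V : finType) (E : {set V * V})
    (Gamma : groupType) (act : Gamma -> V -> V) : Prop :=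
  forall i j k l, (i, j) \in E -> (k, l) \in E ->
    exists g, (act g i = k /\ act g j = l) \/ (act g i = l /\ act g j = k).

Definition edge_boundary (V : finType) (E : {set V * V}) (T : {set V})
    : {set V * V} :=
  (setX T (~: T) :|: setX (~: T) T) :&: E.

(* The clause kappa j i = kappa i j only fixes the values of kappa on reversed
   edges, which by orientedness occur nowhere else in the problem. *)
Definition W_feasible (R : realType) (V : finType) (E : {set V * V})
    (Sc : {set {set V}}) (kappa : V -> V -> R) (eta : V -> R) : Prop :=
  [/\ \sum_(e in E) kappa e.1 e.2 <= 1,
      forall T S : {set V}, S \in Sc -> T \subset S ->
        \sum_(i in T) eta i <= \sum_(e in edge_boundary E T) kappa e.1 e.2,
      forall i j, (i, j) \in E -> 0 <= kappa i j
    & forall i j, (i, j) \in E -> kappa j i = kappa i j].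

Definition W_optimal (R : realType) (V : finType) (E : {set V * V})
    (Sc : {set {set V}}) (kappa : V -> V -> R) (eta : V -> R) : Prop :=
  W_feasible E Sc kappa eta /\
  forall (kappa' : V -> V -> R) (eta' : V -> R),
    W_feasible E Sc kappa' eta' -> \sum_i eta' i <= \sum_i eta i.

(* Main.v *)
From mathcomp Require Import classical_sets topology normedtype derive.
Require Import Defs.
From mathcomp Require Import all_boot all_order all_algebra all_fingroup.
From mathcomp Require Import reals.

Set Implicit Arguments.
Unset Strict Implicit.
Unset Printing Implicit Defensive.

Import Order.TTheory GRing.Theory Num.Theory.
Import numFieldNormedType.Exports.
Local Open Scope ring_scope.

(** A solution of (W) can be averaged over symmetries: feasibility is preserved
    by composing [kappa] and [eta] with an automorphism of the graph that
    permutes the family of sets, the constraints are convex, and the objective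
    is linear and unchanged by relabelling the vertices.  So, starting from any
    optimal solution, the mean of its translates is again optimal, and it is
    invariant under the symmetries.  If these act transitively on vertices,
    then [eta] is constant.  If they act transitively on edges, then [kappa] is
    constant on edges, with a value at most 1 / |E| because the total weight is
    at most 1; raising it to exactly 1 / |E| only enlarges the right-hand sides
    of the isoperimetric constraints ([W_optimal_uniform]).  Both operations
    can be combined.

    The group acting may be infinite, so the mean is taken over the finite
    group [W_symmetries] of all permutations of the vertices that preserve
    adjacency and the family of sets; it contains the permutation given by
    each group element ([action_perm_symmetry]), and averaging over a larger
    group yields at least as much invariance ([W_optimal_invariant]).

    It remains that an optimal solution exists ([W_optimal_exists]).  Since the
    sets cover the vertices, every singleton constraint is present, which
    bounds each [eta i] by 1; when the objective is nonnegative this also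
    bounds each [eta i] from below.  The values of [kappa] on edges lie in
    [0, 1], and those on non-adjacent pairs may be set to 0.  Hence the maximum
    may be sought in a closed subset of a compact box. *)

(** * Maximization over closed subsets of a box *)

Lemma closed_le_fun (R : realType) (T : topologicalType) (f g : T -> R) :
  continuous f -> continuous g ->
  topology_structure.closed [set x | f x <= g x]%classic.
Proof.
move=> cf cg.
have -> : [set x | f x <= g x]%classic =
          ((fun x => g x - f x) @^-1` [set y | 0 <= y])%classic.
  by apply/seteqP; split=> x /=; rewrite subr_ge0.
apply: preimage_closed; last exact: closed_ge.
by move=> x _; apply: continuousB; [exact: cg | exact: cf].
Qed.

Lemma continuous_sum_coord (R : realType) (I J : finType) (A : {pred J})
    (h : J -> I) :
  continuous (fun x : {ptws I -> R} => \sum_(j in A) x (h j)).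
Proof.
apply: continuous_big => [|j _]; first exact: add_continuous.
exact: (@proj_continuous I (fun=> R) (h j)).
Qed.

(** [C] itself may be unbounded: the competitors are restricted to the box,
    which makes the intersection compact by Tychonoff. *)
Lemma max_on_box (R : realType) (I : finType) (M : R)
    (C : classical_sets.set {ptws I -> R}) (f : {ptws I -> R} -> R) :
  topology_structure.closed C -> continuous f ->
  (exists2 x, C x & forall i, `|x i| <= M) ->
  exists2 x, C x & forall y, C y -> (forall i, `|y i| <= M) -> f y <= f x.
Proof.
move=> clC cf [x0 Cx0 x0M].
pose box : classical_sets.set {ptws I -> R} :=
  [set x | forall i, `[- M, M]%classic (x i)]%classic.
have inbox x : (forall i, `|x i| <= M) -> box x.
  by move=> xM i; rewrite /= in_itv /= -ler_norml.
have cbox : compact box.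
  exact: (@tychonoff I (fun=> R) _ (fun=> @segment_compact R (- M) M)).
have cBC := compact_closedI cbox clC.
have BC0 : (box `&` C !=set0)%classic by exists x0; split=> //; exact: inbox.
have [x xBC maxx] :=
  compact_EVT_max BC0 cBC (continuous_subspaceT cf).
have [_ Cx] := set_mem xBC.
exists x => // y Cy yM; apply: maxx; apply: mem_set; split=> //; exact: inbox.
Qed.

(** * Existence of an optimal solution *)

Section FeasibleSet.
Variables (R : realType) (V : finType) (E : {set V * V}) (Sc : {set {set V}}).

Lemma edge_boundaryE (T : {set V}) (e : V * V) :
  (e \in edge_boundary E T) = (e \in E) && ((e.1 \in T) (+) (e.2 \in T)).
Proof.
by case: e => i j; rewrite !inE /= andbC; case: (i \in T); case: (j \in T).
Qed.

Lemma feasible_sym (kappa : V -> V -> R) (eta : V -> R) i j :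
  W_feasible E Sc kappa eta -> adjacent E i j -> kappa j i = kappa i j.
Proof. by case=> _ _ _ sym /orP[] /sym ->. Qed.

Lemma feasible_kappa_le1 (kappa : V -> V -> R) (eta : V -> R) (e : V * V) :
  W_feasible E Sc kappa eta -> e \in E -> kappa e.1 e.2 <= 1.
Proof.
case=> tot _ pos _ eE; apply: le_trans tot; rewrite (bigD1 e) //= lerDl.
by apply: sumr_ge0 => -[i j] /andP[/pos].
Qed.

(** As the family covers the vertices, the constraint for the singleton [i]
    is one of the constraints, and its boundary weight is at most the total. *)
Lemma feasible_eta_le1 (kappa : V -> V -> R) (eta : V -> R) (i : V) :
  cover Sc = [set: V] -> W_feasible E Sc kappa eta -> eta i <= 1.
Proof.
move=> cov [tot iso pos _]; apply: le_trans tot.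
have /bigcupP[S ScS iS] : i \in cover Sc by rewrite cov.
have := iso [set i] S ScS; rewrite sub1set big_set1 => /(_ iS) /le_trans; apply.
rewrite [leRHS](bigID (mem (edge_boundary E [set i]))) /=.
rewrite (eq_bigl (fun e => (e \in E) && (e \in edge_boundary E [set i]))).
  by rewrite lerDl; apply: sumr_ge0 => -[j k] /andP[/pos].
by move=> e; rewrite edge_boundaryE andbA andbb.
Qed.

(** A pair [(kappa, eta)] is encoded as one point of a finite power of [R],
    whose coordinates are the ordered pairs of vertices (left summand) and the
    vertices (right summand). *)
Lemma closed_feasible :
  topology_structure.closed
    [set x : {ptws (V * V + V) -> R} |
      W_feasible E Sc (fun i j => x (inl (i, j))) (fun i => x (inr i))]%classic.
Proof.
have coord k : continuous (fun x : {ptws (V * V + V) -> R} => x k).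
  exact: (@proj_continuous _ (fun=> R) k).
have kappa_sum (A : {set V * V}) :
    continuous (fun x : {ptws (V * V + V) -> R} =>
                  \sum_(e in A) x (inl (e.1, e.2))).
  apply: (@continuous_sum_coord _ _ _ _ (fun e => inl (e.1, e.2))).
have cst (c : R) : continuous (fun _ : {ptws (V * V + V) -> R} => c).
  exact: cst_continuous.
have -> : [set x : {ptws (V * V + V) -> R} |
      W_feasible E Sc (fun i j => x (inl (i, j))) (fun i => x (inr i))]%classic
  = ([set x | \sum_(e in E) x (inl (e.1, e.2)) <= 1] `&`
    ((\bigcap_(TS in [set TS : {set V} * {set V} |
                      (TS.2 \in Sc) && (TS.1 \subset TS.2)])
       [set x | \sum_(i in TS.1) x (inr i) <=
                \sum_(e in edge_boundary E TS.1) x (inl (e.1, e.2))]) `&`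
    ((\bigcap_(e in [set e | e \in E]) [set x | 0 <= x (inl (e.1, e.2))]) `&`
     ((\bigcap_(e in [set e | e \in E])
         [set x | x (inl (e.2, e.1)) <= x (inl (e.1, e.2))]) `&`
     (\bigcap_(e in [set e | e \in E])
         [set x | x (inl (e.1, e.2)) <= x (inl (e.2, e.1))])))))%classic.
  apply/seteqP; split=> x /=.
    case=> tot iso pos sym; split=> //; split.
      by move=> -[T S] /andP[/= ScS TS]; exact: (iso T S).
    split; first by move=> [i j] /= /pos.
    by split=> -[i j] /= /sym ->.
  case=> tot [iso [pos [sym1 sym2]]]; split=> //.
  - by move=> T S ScS TS; apply: (iso (T, S)); rewrite /= ScS.
  - by move=> i j ijE; apply: (pos (i, j)).
  - move=> i j ijE; apply/eqP; rewrite eq_le.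
    by rewrite (sym1 (i, j) ijE) (sym2 (i, j) ijE).
by repeat first [apply: closedI | apply: closed_bigI => ? _];
  apply: closed_le_fun => //; exact: (@continuous_sum_coord _ _ _ _ inr).
Qed.

(** The zero solution is feasible, so only competitors with nonnegative
    objective matter, and those can be moved into a fixed box without changing
    the objective. *)
Lemma W_optimal_exists :
  cover Sc = [set: V] ->
  exists (kappa : V -> V -> R) (eta : V -> R), W_optimal E Sc kappa eta.
Proof.
move=> cov.
pose obj (x : {ptws (V * V + V) -> R}) := \sum_(i in V) x (inr i).
have cobj : continuous obj by exact: (@continuous_sum_coord _ _ _ _ inr).
have feas0 : W_feasible E Sc (fun _ _ => 0 : R) (fun=> 0).
  split=> // [|T S _ _]; first by rewrite big1 ?ler01.
  by rewrite !big1.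
(* 1 bounds kappa and eta from above, and |V| bounds - eta from above. *)
pose M : R := 1 + #|V|%:R.
have M1 : 1 <= M by rewrite lerDl.
have [|x xF xmax] := @max_on_box R _ M _ _ closed_feasible cobj.
  by exists (fun=> 0) => // i; rewrite normr0 (le_trans ler01).
exists (fun i j => x (inl (i, j))), (fun i => x (inr i)); split=> // k h khF.
have obj_ge0 : 0 <= \sum_i x (inr i).
  have := xmax (fun=> 0) feas0; rewrite /obj big1 //; apply=> i.
  by rewrite normr0 (le_trans ler01).
have [h_lt0|h_ge0] := ltP (\sum_i h i) 0; first exact: le_trans (ltW h_lt0) _.
(* Feasibility leaves k unbounded on non-adjacent pairs; cut it off there. *)
pose k' i j := if adjacent E i j then k i j else 0.
pose y (s : V * V + V) := match s with inl e => k' e.1 e.2 | inr i => h i end.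
have k'E (e : V * V) : e \in E -> k' e.1 e.2 = k e.1 e.2.
  by case: e => i j ijE; rewrite /k' /adjacent ijE.
have k'sym i j : k' j i = k' i j.
  rewrite /k' /adjacent orbC; case: ifP => // ij; exact: feasible_sym khF ij.
apply: (xmax y) => [|[[i j]|i]] /=.
- case: khF => tot iso pos sym; split=> //=.
  + by rewrite (eq_bigr _ (fun e => k'E e)).
  + move=> T S ScS TS; rewrite [leRHS](eq_bigr (fun e => k e.1 e.2)).
      exact: iso ScS TS.
    by move=> e; rewrite edge_boundaryE => /andP[/k'E].
  + by move=> i j ijE; rewrite (k'E (i, j)) //=; exact: pos.
- rewrite /k'; case: ifP => [ij|_]; last by rewrite normr0 (le_trans ler01).
  apply: le_trans M1.
  have kle e (eE : e \in E) : `|k e.1 e.2| <= 1.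
    rewrite ger0_norm; first exact: feasible_kappa_le1 khF eE.
    by case: khF => _ _ pos _; apply: pos; rewrite -surjective_pairing.
  case/orP: (ij) => /kle //=; by rewrite (feasible_sym khF ij).
(* The other entries of h are at most 1 and the total is nonnegative. *)
- have h1 j : h j <= 1 by exact: feasible_eta_le1 khF.
  rewrite ler_norml (le_trans (h1 i) M1) andbT lerNl.
  move: h_ge0; rewrite (bigD1 i) //= -lerBlDl sub0r => /le_trans; apply.
  apply: (@le_trans _ _ (\sum_(j : V | j != i) 1)); first exact: ler_sum.
  rewrite sumr_const; apply: (@le_trans _ _ #|V|%:R).
    by rewrite ler_nat max_card.
  by rewrite lerDr.
Qed.

End FeasibleSet.

(** * Symmetries of the problem *)

Section Symmetries.
Variables (R : realType) (V : finType) (E : {set V * V}) (Sc : {set {set V}}).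
Hypothesis hE : oriented_graph E.

(** An automorphism may reverse edges, so it does not permute [E]; it does
    permute the ordered adjacent pairs.  This lemma and its two consequences
    turn the sums over [E] in (W) into sums over ordered adjacent pairs, where
    a change of variables is available. *)
Lemma sum_adjacent (kappa : V -> V -> R) (Q : rel V) :
  (forall i j, adjacent E i j -> kappa j i = kappa i j) ->
  \sum_(e : V * V | adjacent E e.1 e.2 && Q e.1 e.2) kappa e.1 e.2 =
  \sum_(e in E | Q e.1 e.2) kappa e.1 e.2 +
  \sum_(e in E | Q e.2 e.1) kappa e.1 e.2.
Proof.
move=> sym; rewrite (bigID (fun e => e \in E)) /=; congr (_ + _).
  by apply: eq_bigl => -[i j]; rewrite /adjacent /= andbC; case: (_ \in E).
pose swap (e : V * V) := (e.2, e.1).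
have swapK : involutive swap by case.
rewrite (reindex_inj (inv_inj swapK)); apply: eq_big => -[i j] /=.
  rewrite /adjacent; have [_ /(_ i j)] := hE.
  case: ((i, j) \in E) => [/(_ isT)|_]; case: ((j, i) \in E) => //=;
    by rewrite ?andbT ?andbF.
by case/andP=> /andP[/sym].
Qed.

Lemma sum_edges_adjacent (kappa : V -> V -> R) :
  (forall i j, adjacent E i j -> kappa j i = kappa i j) ->
  (\sum_(e in E) kappa e.1 e.2) *+ 2 =
  \sum_(e : V * V | adjacent E e.1 e.2) kappa e.1 e.2.
Proof.
move=> sym; have := @sum_adjacent kappa (fun _ _ => true) sym.
under eq_bigl do rewrite andbT.
move=> ->; rewrite mulr2n; by congr (_ + _); apply: eq_bigl => e; rewrite andbT.
Qed.

Lemma sum_boundary_adjacent (kappa : V -> V -> R) (T : {set V}) :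
  (forall i j, adjacent E i j -> kappa j i = kappa i j) ->
  \sum_(e in edge_boundary E T) kappa e.1 e.2 =
  \sum_(e : V * V | adjacent E e.1 e.2 && ((e.1 \in T) && (e.2 \notin T)))
     kappa e.1 e.2.
Proof.
move=> sym; rewrite (@sum_adjacent _ (fun i j => (i \in T) && (j \notin T))) //.
rewrite (bigID (fun e : V * V => e.1 \in T)) /=.
congr (_ + _); apply: eq_bigl => e; rewrite edge_boundaryE;
  by case: (e.1 \in T); case: (e.2 \in T); rewrite ?andbT ?andbF.
Qed.

(** The vertex permutations that preserve all the data of (W); unlike the group
    acting in the theorem, this group is always finite. *)
Definition W_symmetries : {set {perm V}} :=
  [set p : {perm V} |
    [forall i, forall j, adjacent E (p i) (p j) == adjacent E i j] &&
    [forall T in Sc, p @: T \in Sc]].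

Lemma W_symmetriesP (p : {perm V}) :
  reflect ((forall i j, adjacent E (p i) (p j) = adjacent E i j) /\
           (forall T : {set V}, T \in Sc -> p @: T \in Sc))
          (p \in W_symmetries).
Proof.
rewrite inE; apply: (iffP andP) => -[adj pS]; split.
- by move=> i j; apply/eqP; move/forallP: adj => /(_ i) /forallP.
- by move=> T TS; move/forall_inP: pS; apply.
- by apply/forallP => i; apply/forallP => j; rewrite adj.
- by apply/forall_inP.
Qed.

Lemma W_symmetries_group_set : group_set W_symmetries.
Proof.
apply/group_setP; split.
  apply/W_symmetriesP; split=> [i j|T TS]; first by rewrite !perm1.
  rewrite (_ : _ @: T = T) // -[RHS]imset_id.
  by apply: eq_imset => i; rewrite perm1.
move=> p q /W_symmetriesP[padj pS] /W_symmetriesP[qadj qS].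
apply/W_symmetriesP; split=> [i j|T TS]; first by rewrite !permM qadj padj.
rewrite (_ : _ @: T = q @: (p @: T)); first by apply/qS/pS.
by rewrite -imset_comp; apply: eq_imset => i; rewrite permM.
Qed.

Canonical W_symmetries_group := Group W_symmetries_group_set.

Lemma sum_adjacent_perm (p : {perm V}) (kappa : V -> V -> R) (Q : rel V) :
  (forall i j, adjacent E (p i) (p j) = adjacent E i j) ->
  \sum_(e : V * V | adjacent E e.1 e.2 && Q (p e.1) (p e.2))
     kappa (p e.1) (p e.2) =
  \sum_(e : V * V | adjacent E e.1 e.2 && Q e.1 e.2) kappa e.1 e.2.
Proof.
move=> padj; pose pp (e : V * V) := (p e.1, p e.2).
have pp_inj : injective pp.
  by move=> [i j] [k l] [] /perm_inj -> /perm_inj ->.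
by rewrite [RHS](reindex_inj pp_inj) /=; apply: eq_bigl => e; rewrite padj.
Qed.

(** The constraint of the new pair on [T] is the constraint of the old pair on
    the image of [T]. *)
Lemma feasible_perm (p : {perm V}) (kappa : V -> V -> R) (eta : V -> R) :
  p \in W_symmetries -> W_feasible E Sc kappa eta ->
  W_feasible E Sc (fun i j => kappa (p i) (p j)) (fun i => eta (p i)).
Proof.
move=> /W_symmetriesP[padj pS] feas.
have sym i j := @feasible_sym R V E Sc kappa eta i j feas.
have psym i j : adjacent E i j -> kappa (p j) (p i) = kappa (p i) (p j).
  by move=> ij; apply: sym; rewrite padj.
case: feas => tot iso pos _; split.
- apply: le_trans tot; rewrite -(ler_pMn2r (isT : (0 < 2)%N)).
  rewrite (@sum_edges_adjacent (fun i j => kappa (p i) (p j))) //.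
  rewrite sum_edges_adjacent //.
  rewrite (eq_bigl (fun e => adjacent E e.1 e.2 && true)) => [|e]; last first.
    by rewrite andbT.
  rewrite (@sum_adjacent_perm p kappa (fun _ _ => true) padj) le_eqVlt.
  by apply/orP; left; apply/eqP/eq_bigl => e; rewrite andbT.
- move=> T S ScS TS.
  have := iso (p @: T) (p @: S) (pS S ScS) (imsetS _ TS).
  rewrite big_imset /=; last by move=> i j _ _; exact: perm_inj.
  rewrite sum_boundary_adjacent // => /le_trans; apply.
  rewrite -(@sum_adjacent_perm p kappa
    (fun i j => (i \in p @: T) && (j \notin p @: T))) //.
  rewrite (@sum_boundary_adjacent (fun i j => kappa (p i) (p j))) // le_eqVlt.
  apply/orP; left; apply/eqP.
  by apply: eq_bigl => e; rewrite !(mem_imset _ _ perm_inj).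
- move=> i j ijE; have : adjacent E (p i) (p j) by rewrite padj /adjacent ijE.
  by move=> padjij; case/orP: (padjij) => /pos //; rewrite (sym _ _ padjij).
- by move=> i j ijE; apply: psym; rewrite /adjacent ijE.
Qed.

(** * Averaging *)

Definition mean (I : finType) (A : {set I}) (f : I -> R) : R :=
  #|A|%:R^-1 * \sum_(a in A) f a.

Lemma mean_sum (I J : finType) (A : {set I}) (B : {pred J}) (f : I -> J -> R) :
  \sum_(b in B) mean A (fun a => f a b) = mean A (fun a => \sum_(b in B) f a b).
Proof. by rewrite /mean -mulr_sumr exchange_big. Qed.

Lemma le_mean (I : finType) (A : {set I}) (f g : I -> R) :
  (forall a, a \in A -> f a <= g a) -> mean A f <= mean A g.
Proof. by move=> fg; rewrite ler_wpM2l ?invr_ge0 // ler_sum. Qed.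

Lemma mean_const (I : finType) (A : {set I}) (c : R) :
  (0 < #|A|)%N -> mean A (fun=> c) = c.
Proof.
move=> A0; rewrite /mean sumr_const -[c *+ _]mulr_natl mulrA mulVf ?mul1r //.
by rewrite pnatr_eq0 -lt0n.
Qed.

(** The constraints of (W) define a convex set. *)
Lemma feasible_mean (I : finType) (A : {set I}) (kappa : I -> V -> V -> R)
    (eta : I -> V -> R) :
  (0 < #|A|)%N ->
  (forall a, a \in A -> W_feasible E Sc (kappa a) (eta a)) ->
  W_feasible E Sc (fun i j => mean A (fun a => kappa a i j))
                  (fun i => mean A (fun a => eta a i)).
Proof.
move=> A0 feas; split.
- rewrite (mean_sum A E (fun a e => kappa a e.1 e.2)) -[leRHS](mean_const 1 A0).
  by apply: le_mean => a /feas[].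
- move=> T S ScS TS; rewrite (mean_sum A T eta).
  rewrite (mean_sum A (edge_boundary E T) (fun a e => kappa a e.1 e.2)).
  by apply: le_mean => a /feas[_ iso _ _]; exact: iso ScS TS.
- move=> i j ijE; rewrite -[leLHS](mean_const 0 A0).
  by apply: le_mean => a /feas[_ _ pos _]; exact: pos.
- move=> i j ijE; congr (_ * _); apply: eq_bigr => a /feas[_ _ _ sym].
  exact: sym.
Qed.

Lemma mean_group_invariant (gT : finGroupType) (G : {group gT})
    (f : gT -> R) (q : gT) :
  q \in G -> mean G (fun p => f (q * p)%g) = mean G f.
Proof.
move=> qG; congr (_ * _); rewrite [RHS](reindex_inj (mulgI q)).
by apply: eq_bigl => p; rewrite groupMl.
Qed.

(** Average an optimal solution over [W_symmetries]: each translate has the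
    same objective value, hence so does the mean. *)
Lemma W_optimal_invariant :
  cover Sc = [set: V] ->
  exists (kappa : V -> V -> R) (eta : V -> R),
    [/\ W_optimal E Sc kappa eta,
        forall p i j, p \in W_symmetries -> kappa (p i) (p j) = kappa i j &
        forall p i, p \in W_symmetries -> eta (p i) = eta i].
Proof.
move=> /(@W_optimal_exists R V E Sc)[k [h [feas opt]]].
pose A := W_symmetries_group.
pose kappa i j := mean A (fun p : {perm V} => k (p i) (p j)).
pose eta i := mean A (fun p : {perm V} => h (p i)).
exists kappa, eta; split.
- split; first by apply: feasible_mean => // p pA; exact: feasible_perm.
  move=> k' h' /opt /le_trans; apply; rewrite mean_sum.
  rewrite -[leLHS](mean_const _ (cardG_gt0 A)); apply: le_mean => p _.
  by rewrite [leLHS](reindex_inj (@perm_inj _ p)).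
- move=> q i j qA; rewrite /kappa -[RHS](mean_group_invariant _ qA).
  by congr (_ * _); apply: eq_bigr => p _; rewrite !permM.
- move=> q i qA; rewrite /eta -[RHS](mean_group_invariant _ qA).
  by congr (_ * _); apply: eq_bigr => p _; rewrite !permM.
Qed.

(** If [kappa] is constant on edges, then its value there is at most 1 / |E|,
    and raising [kappa] to this value relaxes every boundary constraint while
    the total weight remains at most 1. *)
Lemma W_optimal_uniform (kappa : V -> V -> R) (eta : V -> R) :
  W_optimal E Sc kappa eta ->
  (forall e f, e \in E -> f \in E -> kappa e.1 e.2 = kappa f.1 f.2) ->
  W_optimal E Sc (fun _ _ => 1 / #|E|%:R) eta.
Proof.
case=> -[tot iso pos sym] opt const; split=> //; split=> //.
- rewrite sumr_const div1r -[_ *+ _]mulr_natl.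
  (* Without edges 1 / |E| is 0, and the total weight is 0 as well. *)
  have [->|E0] := eqVneq #|E| 0%N; first by rewrite mul0r ler01.
  by rewrite mulfV ?pnatr_eq0.
- move=> T S ScS TS; apply: le_trans (iso T S ScS TS) _.
  apply: ler_sum => e; rewrite edge_boundaryE => /andP[eE _].
  have E0 : (0 < #|E|)%N by apply/card_gt0P; exists e.
  rewrite ler_pdivlMr ?ltr0n // mulr_natr.
  apply: le_trans tot; rewrite -sumr_const.
  by apply: ler_sum => f fE; rewrite (const e f).
- by move=> i j _; rewrite divr_ge0.
Qed.

End Symmetries.

Lemma action_perm_symmetry (V : finType) (E : {set V * V})
    (Gamma : groupType) (act : Gamma -> V -> V) (S : V -> {set V}) (g : Gamma) :
  acts_by_automorphisms E act ->
  (forall (g : Gamma) (i : V), act g @: S i = S (act g i)) ->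
  exists2 p : {perm V}, p \in W_symmetries E [set S i | i : V] &
    forall i, p i = act g i.
Proof.
move=> [_ /(_ g) [bij adj]] hS.
exists (perm (bij_inj bij)) => [|i]; last by rewrite permE.
apply/W_symmetriesP; split=> [i j|_ /imsetP[i _ ->]]; first by rewrite !permE.
rewrite (eq_imset _ (permE _)) hS; exact: imset_f.
Qed.

Theorem theorem6p1 (R : realType) (V : finType) (E : {set V * V})
    (hE : oriented_graph E)
    (Gamma : groupType) (act : Gamma -> V -> V)
    (hact : acts_by_automorphisms E act)
    (S : V -> {set V})
    (hS : forall (g : Gamma) (i : V), act g @: S i = S (act g i))
    (hcov : cover [set S i | i : V] = [set: V]) :
  (vertex_transitive act ->
     exists (kappa : V -> V -> R) (eta : V -> R),
       W_optimal E [set S i | i : V] kappa eta /\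
       (forall i j, eta i = eta j)) /\
  (edge_transitive E act ->
     exists (kappa : V -> V -> R) (eta : V -> R),
       W_optimal E [set S i | i : V] kappa eta /\
       (forall i j, (i, j) \in E -> kappa i j = 1 / #|E|%:R)) /\
  (edge_transitive E act -> vertex_transitive act ->
     exists (kappa : V -> V -> R) (eta : V -> R),
       [/\ W_optimal E [set S i | i : V] kappa eta,
           (forall i j, eta i = eta j) &
           (forall i j, (i, j) \in E -> kappa i j = 1 / #|E|%:R)]).
Proof.
have [kappa [eta [opt kinv hinv]]] := @W_optimal_invariant R V E _ hE hcov.
(* eta from the invariant solution serves in all three parts; kappa is raised
   to 1 / |E| in the last two. *)
have actP g := action_perm_symmetry g hact hS.
have eta_const : vertex_transitive act -> forall i j, eta i = eta j.
  move=> vtrans i j; have [g <-] := vtrans i j.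
  by have [p pA <-] := actP g; rewrite hinv.
have opt_unif : edge_transitive E act ->
    W_optimal E [set S i | i : V] (fun _ _ => 1 / #|E|%:R : R) eta.
  move=> etrans; apply: (W_optimal_uniform opt) => -[i j] [k l] /= ijE klE.
  have [g] := etrans i j k l ijE klE; have [p pA pg] := actP g.
  rewrite -!pg -(kinv p i j pA) => -[[-> ->] // | [-> ->]].
  by case: opt => -[_ _ _ sym] _; exact: sym.
split; first by move=> /eta_const etaE; exists kappa, eta.
split=> [/opt_unif optE | /opt_unif optE /eta_const etaE].
  by exists (fun _ _ => 1 / #|E|%:R), eta.
by exists (fun _ _ => 1 / #|E|%:R), eta.
Qed.
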